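(* Let $n\ge2$ and identify $O_n'=O_n\cap\{y_1=0\}$ with a cone in $\mathbb R^{n-1}$ with coordinates $(y_2,\ldots,y_n)$. The linear map $\varphi:(y_2,\ldots,y_n)\mapsto(x_1,\ldots,x_{n-1})$ given by \[ x_1=\tfrac1n y_n,\qquad x_i=\tfrac in y_n-y_i\quad(2\le i\le n-1) \] maps $O_n'$ bijectively onto the group cone $\mathcal C(\mathbb Z_n)$. Moreover, if a numerical semigroup $S$ corresponds to an integer point $y$ in the relative interior of a face $F$ of $O_n'$, then $\mathcal A(S;n)$ equals the image of the Kunz poset of the face $\varphi(F)$ of $\mathcal C(\mathbb Z_n)$ under the automorphism $\sigma$ of $\mathbb Z_n$ with $\sigma(1)=y_n \bmod n$ applied to each element of the ground set (i.e. $\sigma(i)\preceq_{\mathcal A(S;n)}\sigma(j)$ iff $i\preceq j$ in the Kunz poset of $\varphi(F)$).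
   Context: The oversemigroup cone $O_n\subset\mathbb R^n$ is the set of $(y_1,\ldots,y_n)$ with $y_i+y_j\le y_{i+j}$ for $1\le i\le j\le n-1$, $i+j<n$, and $y_i+y_j\le y_{i+j-n}+y_n$ for $1\le i\le j\le n-1$, $i+j>n$. The group cone $\mathcal C(\mathbb Z_n)\subset\mathbb R^{n-1}$ (coordinates indexed by nonzero residues $1,\ldots,n-1$) is the set of $x$ with $x_a+x_b\ge x_{a+b}$ for all nonzero $a,b\in\mathbb Z_n$ with $a+b\ne0$. For a face $F'$ of $\mathcal C(\mathbb Z_n)$ with $x_h\neq 0$ somewhere on $F'$ for every $h\ne0$ (trivial Kunz subgroup), its Kunz poset is the partial order $\preceq$ on $\mathbb Z_n$ (it exists) such that for nonzero $a,b$ with $a+b\ne0$: $x_a+x_b=x_{a+b}$ for all $x\in F'$ iff $a\preceq a+b$. A numerical semigroup is a subset $S\subseteq\mathbb Z_{\ge0}$ closed under addition with finite complement; for $n\in S$, $\mathrm{Ap}(S;n)=\{s\in S:s-n\notin S\}=\{a_0=0,a_1,\ldots,a_{n-1}\}$ with $a_i\equiv i\pmod n$, and the Kunz poset $\mathcal A(S;n)$ is the poset on $\mathbb Z_n$ with $i\preceq j$ iff $a_j-a_i\in S$. An integer point $y\in O_n$ with $\gcd(y_n,n)=1$ corresponds to the numerical semigroup $S$ containing $n$ and $y_n$ with $\mathrm{Ap}(S;n)=\{iy_n-ny_i:1\le i\le n\}$. *)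

(* Defs.v *)
From HB Require Import structures.
From mathcomp Require Import all_boot all_order all_algebra.
From mathcomp Require Import all_classical all_reals all_analysis.
Set Implicit Arguments.
Unset Strict Implicit.
Unset Printing Implicit Defensive.
Import Order.TTheory GRing.Theory Num.Theory.
Import numFieldNormedType.Exports.
Local Open Scope classical_set_scope.
Local Open Scope ring_scope.

(* [crd v i] is the i-th coordinate of v, numbered from 1; it is 0 when i is
   not in {1, ..., m}. *)
Definition crd (T : nmodType) (m : nat) (v : 'rV[T]_m) (i : nat) : T :=
  if i is k.+1 then oapp (v ord0) 0 (insub k) else 0.

Section Polyhedra.
Variables (R : realType) (m : nat).
Implicit Types P F A : set 'rV[R]_m.

(* Intersections of P with {c . x = d}, where c . x >= d is valid on P; this
   includes P itself (c = 0, d = 0). *)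
Definition is_face P F : Prop :=
  exists (c : 'cV[R]_m) (d : R),
    (forall x, P x -> d <= (x *m c) ord0 ord0) /\
    F = [set x | P x /\ (x *m c) ord0 ord0 = d].

Definition affine_hull A : set 'rV[R]_m :=
  [set z | exists (k : nat) (v : 'I_k -> 'rV[R]_m) (t : 'I_k -> R),
     [/\ forall i, A (v i), \sum_i t i = 1 & z = \sum_i t i *: v i]].

Definition relative_interior A : set 'rV[R]_m :=
  [set y | A y /\ \forall z \near y, affine_hull A z -> A z].

End Polyhedra.

Section Cones.
Variables (R : numDomainType) (n : nat).

Definition oversemigroup_cone : set 'rV[R]_n :=
  [set y |
    (forall i j : nat, (1 <= i)%N -> (i <= j)%N -> (j <= n.-1)%N ->
       (i + j < n)%N -> crd y i + crd y j <= crd y (i + j)%N) /\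
    (forall i j : nat, (1 <= i)%N -> (i <= j)%N -> (j <= n.-1)%N ->
       (n < i + j)%N -> crd y i + crd y j <= crd y (i + j - n)%N + crd y n)].

(* The coordinate of x at a nonzero residue a is [crd x a], where the coercion
   'Z_n >-> nat gives the representative of a in {1, ..., n-1}; only
   meaningful for n >= 2. *)
Definition group_cone : set 'rV[R]_n.-1 :=
  [set x | forall a b : 'Z_n, a != 0 -> b != 0 -> a + b != 0 ->
     crd x ((a + b)%R : 'Z_n) <= crd x a + crd x b].

End Cones.

(* (y_2, ..., y_n) |-> (0, y_2, ..., y_n). *)
Definition pad (T : nmodType) (n : nat) (v : 'rV[T]_n.-1) : 'rV[T]_n :=
  \row_(i < n) (if (i : nat) is k.+1 then crd v k.+1 else 0).

(* O_n' as a subset of R^(n-1), with coordinates (y_2, ..., y_n). *)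
Definition oversemigroup_cone' (R : numDomainType) (n : nat) :
    set 'rV[R]_n.-1 :=
  [set v | oversemigroup_cone (pad v)].

Definition phi (R : numFieldType) (n : nat) (v : 'rV[R]_n.-1) : 'rV[R]_n.-1 :=
  let y := pad v in
  \row_(k < n.-1)
    (if (k : nat) == 0%N then 1 / n%:R * crd y n
     else k.+1%:R / n%:R * crd y n - crd y k.+1).

Section GroupConeFaces.
Variables (R : numDomainType) (n : nat) (F : set 'rV[R]_n.-1).

Definition trivial_kunz_subgroup : Prop :=
  forall h : 'Z_n, h != 0 -> exists2 x, F x & crd x h != 0.

(* The last condition only determines le on pairs of nonzero residues; as
   usual for Kunz posets, 0 is the least element. *)
Definition is_kunz_poset (le : rel 'Z_n) : Prop :=
  [/\ reflexive le, antisymmetric le, transitive le,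
      forall a, le 0 a
    & forall a b : 'Z_n, a != 0 -> b != 0 -> a + b != 0 ->
        (forall x, F x -> crd x a + crd x b = crd x ((a + b)%R : 'Z_n)) <->
        le a (a + b)].

End GroupConeFaces.

Definition numerical_semigroup (S : set int) : Prop :=
  [/\ S `<=` [set s | 0 <= s], S 0,
      forall s t, S s -> S t -> S (s + t)
    & finite_set [set s : int | 0 <= s /\ ~ S s]].

Definition apery (S : set int) (n : nat) : set int :=
  [set s | S s /\ ~ S (s - n%:Z)].

(* The element a_i of Ap(S; n) congruent to i mod n (unique when S is a
   numerical semigroup containing n >= 2). *)
Definition apery_elt (S : set int) (n : nat) (i : 'Z_n) : int :=
  xget 0 [set a | apery S n a /\ a%:~R = i].

Definition semigroup_kunz_le (S : set int) (n : nat) (i j : 'Z_n) : Prop :=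
  S (apery_elt S j - apery_elt S i).

Definition corresponds (n : nat) (y : 'rV[int]_n) (S : set int) : Prop :=
  [/\ oversemigroup_cone y, gcdz (crd y n) n%:Z = 1 &
   [/\ numerical_semigroup S, S n%:Z, S (crd y n)
     & apery S n =
       [set a | exists i : nat, (1 <= i <= n)%N /\
                  a = i%:Z * crd y n - n%:Z * crd y i]]].

(* Main.v *)
(* The formula for phi is [x_i = (i/n) y_n - y_i] for all residues [i] (with
   [y_0 = y_1 = 0]); under it each inequality of [O_n'] becomes the
   subadditivity inequality of the group cone with the same indices, and phi has
   an explicit linear inverse.  At an integer point, [n x_i] is the Apery element
   [A_i] in the class of [i y_n].  Since Apery elements are minimal in their
   classes, [A_(a+b) - A_a] lies in [S] iff [A_a + A_b = A_(a+b)].  This is the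
   vanishing at [y] of a linear form that is nonnegative on [F], and for a
   relative interior point that forces the form to vanish on all of [F]. *)

Require Import Defs.
From HB Require Import structures.
From mathcomp Require Import all_boot all_order all_algebra.
From mathcomp Require Import all_classical all_reals all_analysis.
From mathcomp Require Import ring lra zify.
Set Implicit Arguments.
Unset Strict Implicit.
Unset Printing Implicit Defensive.
Import Order.TTheory GRing.Theory Num.Theory.
Import numFieldNormedType.Exports.
Local Open Scope classical_set_scope.
Local Open Scope ring_scope.

Arguments crd : simpl never.

(** * Coordinates numbered from 1, with default value 0 *)

Lemma crd0 (T : nmodType) (m : nat) (v : 'rV[T]_m) : crd v 0 = 0.
Proof. by []. Qed.

Lemma crd_ord (T : nmodType) (m : nat) (v : 'rV[T]_m) (k : 'I_m) :
  crd v k.+1 = v ord0 k.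
Proof. by rewrite /crd valK. Qed.

Lemma crdE (T : nmodType) (m k : nat) (v : 'rV[T]_m) (km : (k < m)%N) :
  crd v k.+1 = v ord0 (Ordinal km).
Proof. by rewrite -crd_ord. Qed.

Lemma crd_out (T : nmodType) (m : nat) (v : 'rV[T]_m) (i : nat) :
  (m < i)%N -> crd v i = 0.
Proof. by case: i => // i; rewrite ltnS /crd => mi; rewrite insubN // -leqNgt. Qed.

Lemma crd_map (T U : nmodType) (f : {additive T -> U}) (m : nat)
    (v : 'rV[T]_m) (i : nat) : crd (map_mx f v) i = f (crd v i).
Proof.
case: i => [|i]; first by rewrite !crd0 raddf0.
have [im|mi] := ltnP i m; last by rewrite !crd_out // raddf0.
by rewrite !crdE mxE.
Qed.

Lemma crd_linear (R : pzRingType) (m i : nat) (a : R) (u v : 'rV[R]_m) :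
  crd (a *: u + v) i = a * crd u i + crd v i.
Proof.
case: i => [|i]; first by rewrite !crd0 mulr0 addr0.
have [im|mi] := ltnP i m; last by rewrite !crd_out // mulr0 addr0.
by rewrite !crdE !mxE.
Qed.

Lemma crd_inj (T : nmodType) (m : nat) (u v : 'rV[T]_m) :
  (forall i, (0 < i <= m)%N -> crd u i = crd v i) -> u = v.
Proof. by move=> uv; apply/rowP => k; rewrite -!crd_ord uv //= ltn_ord. Qed.

Lemma crd_pad1 (T : nmodType) (n : nat) (v : 'rV[T]_n.-1) : crd (pad v) 1 = 0.
Proof. by case: n v => [|n] v; [rewrite crd_out | rewrite crdE mxE]. Qed.

Lemma crd_padS (T : nmodType) (n k : nat) (v : 'rV[T]_n.-1) :
  crd (pad v) k.+2 = crd v k.+1.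
Proof.
have [kn|nk] := ltnP k.+1 n; last by rewrite !crd_out //; lia.
by rewrite crdE mxE.
Qed.

Lemma crd_pad_map (T U : nmodType) (f : {additive T -> U}) (n i : nat)
    (v : 'rV[T]_n.-1) : crd (pad (map_mx f v)) i = f (crd (pad v) i).
Proof.
by case: i => [|[|i]]; rewrite ?crd0 ?crd_pad1 ?crd_padS ?crd_map ?raddf0.
Qed.

Lemma crd_pad_linear (R : pzRingType) (n i : nat) (a : R) (u v : 'rV[R]_n.-1) :
  crd (pad (a *: u + v)) i = a * crd (pad u) i + crd (pad v) i.
Proof.
by case: i => [|[|i]]; rewrite ?crd0 ?crd_pad1 ?crd_padS ?crd_linear ?mulr0 ?addr0.
Qed.

(* The convention [crd _ 0 = 0] makes the formula hold at [i = 0] too. *)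
Lemma crd_phi (R : numFieldType) (n i : nat) (v : 'rV[R]_n.-1) : (i < n)%N ->
  crd (phi v) i = i%:R / n%:R * crd (pad v) n - crd (pad v) i.
Proof.
case: i => [|i] iN; first by rewrite !crd0 mul0r mul0r subr0.
have iN' : (i < n.-1)%N by lia.
rewrite crdE mxE /=; case: eqP => // ->.
by rewrite crd_pad1 subr0.
Qed.

(** * Linearity and invertibility of [phi] *)

Lemma phi_linear (R : numFieldType) (n : nat) : linear (@phi R n).
Proof.
move=> a u v; apply: crd_inj => i i_lt; have iN : (i < n)%N by lia.
rewrite crd_linear !crd_phi // !crd_pad_linear; ring.
Qed.

(** Since [x_1 = y_n / n], one recovers [y_i = i x_1 - x_i]. Entry [k] is [y_(k+2)]; in the last one
    [crd x n] is the default 0, which gives [y_n = n x_1]. *)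
Definition phi_inv (R : numFieldType) (n : nat) (x : 'rV[R]_n.-1) :
    'rV[R]_n.-1 :=
  \row_(k < n.-1) (k.+2%:R * crd x 1 - crd x k.+2).

Lemma crd_pad_phi_inv (R : numFieldType) (n i : nat) (x : 'rV[R]_n.-1) :
  (0 < i <= n)%N -> crd (pad (phi_inv x)) i = i%:R * crd x 1 - crd x i.
Proof.
case: i => [//|[|i]] iN; first by rewrite crd_pad1 mul1r subrr.
have iN' : (i < n.-1)%N by lia.
by rewrite crd_padS crdE mxE.
Qed.

Lemma phi_invK (R : numFieldType) (n : nat) : (0 < n)%N ->
  cancel (@phi_inv R n) (@phi R n).
Proof.
move=> n0 x; apply: crd_inj => i i_lt.
have nz : n%:R != 0 :> R by rewrite pnatr_eq0; lia.
rewrite crd_phi ?crd_pad_phi_inv; [|lia..].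
rewrite (@crd_out _ _ x n); last by lia.
by field.
Qed.

Lemma phiK (R : numFieldType) (n : nat) : (1 < n)%N ->
  cancel (@phi R n) (@phi_inv R n).
Proof.
move=> n1 v; apply: crd_inj => -[//|i] i_lt.
have nz : n%:R != 0 :> R by rewrite pnatr_eq0; lia.
(* The last coordinate is apart: [crd (phi v) n] is out of range, hence 0, and [crd_phi] is used at
   index 1 only. *)
have [i_n|i_n] := eqVneq i.+2 n.
  rewrite -crd_padS crd_pad_phi_inv; last by lia.
  rewrite (@crd_out _ _ _ i.+2); last by lia.
  by rewrite crd_phi // crd_pad1 -crd_padS i_n; field.
rewrite -crd_padS crd_pad_phi_inv; last by lia.
rewrite !crd_phi; [|lia..].
by rewrite crd_pad1 -crd_padS; field.
Qed.

Lemma phi_inv_linear (R : numFieldType) (n : nat) : linear (@phi_inv R n).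
Proof. by move=> a u v; apply/rowP => k; rewrite !mxE !crd_linear; ring. Qed.

HB.instance Definition _ (R : numFieldType) (n : nat) :=
  GRing.isLinear.Build R _ _ _ (@phi_inv R n) (@phi_inv_linear R n).

(** * Residues modulo [n] and comparison of the two cones *)

Lemma val_ZpD (n : nat) (a b : 'Z_n) : (1 < n)%N ->
  (a + b)%R = ((a + b) %% n)%N :> nat.
Proof. by move=> n1; congr (_ %% _)%N; apply: Zp_cast. Qed.

Lemma ltn_Zp (n : nat) (a : 'Z_n) : (1 < n)%N -> (a < n)%N.
Proof. by move=> n1; apply: leq_trans (ltn_ord a) (eq_leq (Zp_cast n1)). Qed.

(** The multiples of [y_n / n] cancel when [i + j < n]; when [i + j > n], reduction modulo [n]
    leaves exactly one copy of [y_n]. *)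
Lemma group_cone_phi (R : numFieldType) (n : nat) (v : 'rV[R]_n.-1) :
  (1 < n)%N -> group_cone (phi v) <-> oversemigroup_cone' v.
Proof.
move=> n1; have nz : n%:R != 0 :> R by rewrite pnatr_eq0; lia.
have phi_lt i j : (0 < i)%N -> (0 < j)%N -> (i + j < n)%N ->
    (crd (phi v) (i + j) <= crd (phi v) i + crd (phi v) j) =
    (crd (pad v) i + crd (pad v) j <= crd (pad v) (i + j)).
  move=> i0 j0 ij; rewrite !crd_phi; [|lia..].
  rewrite -subr_ge0 -[RHS]subr_ge0; congr (0 <= _).
  by rewrite natrD; field.
have phi_gt i j : (i < n)%N -> (j < n)%N -> (n < i + j)%N ->
    (crd (phi v) (i + j - n) <= crd (phi v) i + crd (phi v) j) =
    (crd (pad v) i + crd (pad v) j <= crd (pad v) (i + j - n) + crd (pad v) n).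
  move=> i_n j_n ij; rewrite !crd_phi; [|lia..].
  rewrite -subr_ge0 -[RHS]subr_ge0; congr (0 <= _).
  by rewrite natrB ?natrD; [field | lia].
have val_nat k : (k < n)%N -> (k%:R : 'Z_n) = k :> nat.
  by move=> kn; rewrite val_Zp_nat // modn_small.
have nat_neq0 k : (0 < k < n)%N -> k%:R != 0 :> 'Z_n.
  by move=> kn; rewrite -(inj_eq (@ord_inj _)) val_nat /=; lia.
have modB i j : (i < n)%N -> (j < n)%N -> (n < i + j)%N ->
    ((i + j) %% n)%N = (i + j - n)%N.
  move=> i_n j_n ij.
  by rewrite -{1}(subnK (ltnW ij)) modnDr modn_small //; lia.
split=> [Cx|[Olt Ogt] a b].
  split=> i j i1 ij jn ijn.
    have := Cx i%:R j%:R; rewrite -natrD !val_nat; [|lia..].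
    by rewrite phi_lt; [|lia..]; apply; apply: nat_neq0; lia.
  have := Cx i%:R j%:R.
  have -> : i%:R + j%:R = (i + j - n)%:R :> 'Z_n.
    by apply: ord_inj; rewrite val_ZpD // !val_nat ?modB; lia.
  rewrite !val_nat; [|lia..].
  by rewrite phi_gt; [|lia..]; apply; apply: nat_neq0; lia.
rewrite -!(inj_eq (@ord_inj _)) val_ZpD //=.
have := ltn_Zp a n1; have := ltn_Zp b n1.
move: (nat_of_ord a) (nat_of_ord b) => {}a {}b bn an a0 b0 ab0.
(* The inequalities of the oversemigroup cone are given only for ordered indices. *)
wlog ab : a b an bn a0 b0 ab0 / (a <= b)%N.
  move=> W; have [ab|/ltnW ba] := leqP a b; first exact: W.
  by rewrite addnC [leRHS]addrC W // addnC.
have [abn|abn|abn] := ltngtP (a + b)%N n.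
- by rewrite modn_small // phi_lt ?Olt //; lia.
- by rewrite modB // phi_gt ?Ogt //; lia.
- by rewrite abn modnn in ab0.
Qed.

Lemma phi_bij (R : numFieldType) (n : nat) : (1 < n)%N ->
  set_bij (@oversemigroup_cone' R n) (@group_cone R n) (@phi R n).
Proof.
move=> n1; split=> [v Ov|u v _ _|x Cx].
- exact/group_cone_phi.
- exact: (can_inj (phiK n1)).
- exists (phi_inv x); last by rewrite phi_invK //; lia.
  by apply/group_cone_phi; rewrite ?phi_invK //; lia.
Qed.

(** * Faces and relative interiors *)

Lemma phi_face (R : realType) (n : nat) (F : set 'rV[R]_n.-1) : (1 < n)%N ->
  is_face (@oversemigroup_cone' R n) F ->
  is_face (@group_cone R n) (@phi R n @` F).
Proof.
move=> n1 [c [d [dO ->]]].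
have n0 : (0 < n)%N by lia.
(* The supporting functional is pulled back along [phi_inv]; the bound [d] is unchanged. *)
exists (lin1_mx (@phi_inv R n) *m c), d; split=> [x Cx|].
  rewrite mulmxA mul_rV_lin1; apply: dO.
  by apply/group_cone_phi; rewrite ?phi_invK.
apply/seteqP; split=> [_ [v [Ov vd] <-]|x [Cx xd]] /=.
  split; first exact/group_cone_phi.
  by rewrite mulmxA mul_rV_lin1 /= phiK.
exists (phi_inv x); last by rewrite phi_invK.
split; first by apply/group_cone_phi; rewrite ?phi_invK.
by rewrite -xd mulmxA mul_rV_lin1.
Qed.

(** Going from [w] a little past [z] stays near [z] and in the affine hull of [A]. *)
Lemma relative_interior_extend (R : realType) (m : nat) (A : set 'rV[R]_m)
    (z w : 'rV[R]_m) : relative_interior A z -> A w ->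
  exists2 e : R, 0 < e & A (z + e *: (z - w)).
Proof.
move=> [Az /nbhs_ballP[r /= r0 zr]] Aw.
(* The summand 1 makes [M] positive even if [z = w], and larger than every coordinate difference, so
   a step [r / M] moves each coordinate by less than [r]. *)
set M := 1 + \sum_j `|z ord0 j - w ord0 j|.
have sum_ge0 : 0 <= \sum_j `|z ord0 j - w ord0 j| by apply: sumr_ge0.
have M0 : 0 < M by rewrite /M; lra.
exists (r / M); first exact: divr_gt0.
apply: zr.
  split=> // i j; rewrite (ord1 i) !mxE /ball /= opprD addrA subrr sub0r normrN.
  rewrite normrM (ger0_norm (ltW (divr_gt0 r0 M0))) -mulrA gtr_pMr //.
  rewrite mulrC ltr_pdivrMr // mul1r /M (bigD1 j) //=.
  have : 0 <= \sum_(i0 < m | i0 != j) `|z ord0 i0 - w ord0 i0|.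
    by apply: sumr_ge0.
  lra.
(* With [e = r / M], the point is the affine combination [(1 + e) z - e w]. *)
exists 2, (fun i : 'I_2 => if i == ord0 then z else w),
  (fun i : 'I_2 => if i == ord0 then 1 + r / M else - (r / M)).
split=> [i||]; first by case: ifP.
- by rewrite !big_ord_recl big_ord0 /=; ring.
- rewrite !big_ord_recl big_ord0 /= scalerDl scale1r scalerBr scaleNr addr0.
  by rewrite addrA.
Qed.

(** At the point past [z] the form takes the value [- e * l w], so [l w] cannot be positive. *)
Lemma scalar_ge0_relative_interior (R : realType) (m : nat)
    (A : set 'rV[R]_m) (l : 'rV[R]_m -> R) (z : 'rV[R]_m) : scalar l ->
  (forall w, A w -> 0 <= l w) -> relative_interior A z -> l z = 0 ->
  forall w, A w -> l w = 0.
Proof.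
move=> l_lin l0 zA lz w Aw; have [e e0 Ae] := relative_interior_extend zA Aw.
have := l0 _ Ae; rewrite addrC l_lin -scaleN1r (addrC z) l_lin lz => lw.
by apply/eqP; rewrite eq_le l0 // andbT; nra.
Qed.

(** * Divisibility by [n] and minimality of Apery elements *)

Lemma intr_Zp_eq0 (n : nat) (a : int) : (1 < n)%N ->
  (a%:~R == 0 :> 'Z_n) = (n%:Z %| a)%Z.
Proof.
move=> n1; have natE k : (k%:R == 0 :> 'Z_n) = (n %| k)%N.
  by rewrite -(inj_eq (@ord_inj _)) val_Zp_nat.
rewrite dvdzE /=; case: a => k; first exact: natE.
by rewrite NegzE rmorphN oppr_eq0 /= natE.
Qed.

Lemma intr_Zp_unit (n : nat) (a : int) : (1 < n)%N -> gcdz a n%:Z = 1 ->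
  (a%:~R : 'Z_n) \is a GRing.unit.
Proof.
move=> n1 an; have [u [w]] := Bezoutz a n%:Z; rewrite an => uw.
apply/unitrP; exists u%:~R.
suff uE : u%:~R * a%:~R = 1 :> 'Z_n by split; rewrite // mulrC.
have := congr1 (fun k : int => k%:~R : 'Z_n) uw.
by rewrite rmorphD !rmorphM /= -pmulrn pchar_Zp // mulr0 addr0.
Qed.

Lemma numerical_semigroupMn (S : set int) (n k : nat) (s : int) :
  numerical_semigroup S -> S n%:Z -> S s -> S (s + k%:Z * n%:Z).
Proof.
move=> [_ _ SD _] Sn Ss; elim: k => [|k IHk]; first by rewrite mul0r addr0.
by rewrite intS mulrDl mul1r addrCA addrC; apply: SD.
Qed.

(** If [s < a], then [a - n] is [s] plus a nonnegative multiple of [n], so it lies in [S], against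
    the Apery condition. *)
Lemma apery_min (S : set int) (n : nat) (a s : int) : (0 < n)%N ->
  numerical_semigroup S -> S n%:Z -> apery S n a -> S s ->
  (n%:Z %| s - a)%Z -> a <= s.
Proof.
move=> n0 SS Sn [Sa San] Ss /dvdzP[k sa]; rewrite leNgt; apply/negP => s_lt.
have k_lt : k < 0 by nia.
apply: San; have -> : a - n%:Z = s + (absz (k + 1))%:Z * n%:Z by nia.
exact: numerical_semigroupMn.
Qed.

Lemma crd_phi_intr (R : numFieldType) (n i : nat) (z : 'rV[int]_n.-1) :
  (i < n)%N ->
  crd (phi (map_mx intr z : 'rV[R]_n.-1)) i =
  (i%:Z * crd (pad z) n - n%:Z * crd (pad z) i)%:~R / n%:R.
Proof.
move=> i_n; have nz : n%:R != 0 :> R by rewrite pnatr_eq0; lia.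
rewrite crd_phi // !crd_pad_map rmorphB !rmorphM /= -!pmulrn.
by field.
Qed.

(** * The semigroup of an integer point *)

Section Corresponds.
Variables (n : nat) (y : 'rV[int]_n) (S : set int).
Hypotheses (n1 : (1 < n)%N) (yS : corresponds y S).

(** [A i] lies in the class of [u * i], not of [i]; hence the twist by [sigma]. *)
Let A (i : nat) : int := i%:Z * crd y n - n%:Z * crd y i.
Let u : 'Z_n := (crd y n)%:~R.

(* The index [n] of the Apery set becomes the residue 0, as [crd y 0 = 0]. *)
Lemma corresponds_apery (a : int) :
  apery S n a <-> exists i : 'Z_n, a = A i.
Proof.
have [_ _ [_ _ _ ->]] := yS; split=> [[i [i_n ->]]|[i ->]].
  have [i_eq|i_neq] := eqVneq i n.
    by exists 0; rewrite /A i_eq crd0 /=; ring.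
  by exists i%:R; rewrite /A val_Zp_nat // modn_small //; lia.
have i_n := ltn_Zp i n1.
have [i0|i0] := eqVneq (i : nat) 0%N; last by exists i; split => //; lia.
by exists n; split; [lia | rewrite /A i0 crd0; ring].
Qed.

Lemma intr_apery (i : 'Z_n) : (A i)%:~R = u * i.
Proof.
rewrite /A rmorphB !rmorphM /= -!pmulrn.
by rewrite pchar_Zp // mul0r subr0 mulrC natr_Zp.
Qed.

Lemma corresponds_unit : u \is a GRing.unit.
Proof. by have [_ gcd1 _] := yS; exact: intr_Zp_unit. Qed.

(** As [u] is a unit, only one value of [A] lies in this class, so [xget] has a single choice. *)
Lemma apery_eltE (i : 'Z_n) : apery_elt S (u * i) = A i.
Proof.
apply: xget_subset1.
  by split; [apply/corresponds_apery; exists i | exact: intr_apery].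
move=> _ _ [/corresponds_apery[j ->] ji] [/corresponds_apery[k ->] ki].
by move: ji ki; rewrite !intr_apery => /(mulrI corresponds_unit)->
  /(mulrI corresponds_unit)->.
Qed.

Lemma semigroup_kunz_leE (i j : 'Z_n) :
  semigroup_kunz_le S (u * i) (u * j) <-> S (A j - A i).
Proof. by rewrite /semigroup_kunz_le !apery_eltE. Qed.

Lemma apery_in (i : 'Z_n) : S (A i).
Proof.
by have /corresponds_apery[] : exists j : 'Z_n, A i = A j by exists i.
Qed.

(* [A (a + b) - A a] and [A b] are congruent mod [n], and [A b] is the least
   element of [S] in its class. *)
Lemma apery_diff (a b : 'Z_n) :
  S (A (a + b)%R - A a) <-> A a + A b = A (a + b)%R.
Proof.
have [_ _ [SS Sn _ _]] := yS; have n0 : (0 < n)%N by lia.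
split=> [Sab|<-]; last by rewrite addrC addKr; apply: apery_in.
have Ab (c : 'Z_n) : apery S n (A c) by apply/corresponds_apery; exists c.
apply/eqP; rewrite eq_le; apply/andP; split.
  rewrite -lerBrDl; apply: (apery_min n0 SS Sn) => //.
  by rewrite -intr_Zp_eq0 // 2!intrB !intr_apery -addrA -opprD -mulrDr subrr.
(* [A (a + b)] is least in its class, which contains [A a + A b]. *)
apply: (apery_min n0 SS Sn) => //.
  by have [_ _ SD _] := SS; apply: SD; apply: apery_in.
by rewrite -intr_Zp_eq0 // intrB intrD !intr_apery -mulrDr subrr.
Qed.

Lemma apery_neq0 (i : 'Z_n) : i != 0 -> A i != 0.
Proof.
move=> i0; apply/eqP => Ai0; have := intr_apery i.
by rewrite Ai0 => /esym/eqP; rewrite mulrI_eq0 ?(negPf i0) //;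
  apply: mulrI corresponds_unit.
Qed.

(** Antisymmetry holds because [S] has no negative elements and [A] determines the residue;
    transitivity is closure of [S] under addition. *)
Lemma semigroup_kunz_le_order :
  let le := [rel i j : 'Z_n | `[< semigroup_kunz_le S (u * i) (u * j) >]] in
  [/\ reflexive le, antisymmetric le, transitive le & forall a, le 0 a].
Proof.
have [_ _ [[S_ge0 S0 SD _] _ _ _]] := yS; split=> [i|i j|j i k|a] /=.
- by apply/asboolP/semigroup_kunz_leE; rewrite subrr.
- move=> /andP[/asboolP/semigroup_kunz_leE/S_ge0/= ij].
  move=> /asboolP/semigroup_kunz_leE/S_ge0/= ji.
  have AE : A i = A j by lia.
  by apply: (mulrI corresponds_unit); rewrite -!intr_apery AE.
- move=> /asboolP/semigroup_kunz_leE ij /asboolP/semigroup_kunz_leE jk.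
  apply/asboolP/semigroup_kunz_leE.
  have -> : A k - A i = (A j - A i) + (A k - A j) by ring.
  exact: SD.
- apply/asboolP/semigroup_kunz_leE.
  have -> : A (0%R : 'Z_n) = 0 by rewrite /A crd0 mul0r mulr0 subr0.
  by rewrite subr0; apply: apery_in.
Qed.

End Corresponds.

Theorem theorem5p4 (R : realType) (n : nat) (hn : (1 < n)%N) :
  [/\ linear (@phi R n),
      set_bij (@oversemigroup_cone' R n) (@group_cone R n) (@phi R n)
    & forall (F : set 'rV[R]_n.-1) (z : 'rV[int]_n.-1) (S : set int),
        is_face (@oversemigroup_cone' R n) F ->
        relative_interior F (map_mx intr z) ->
        corresponds (pad z) S ->
        [/\ is_face (@group_cone R n) (@phi R n @` F),
            trivial_kunz_subgroup (@phi R n @` F)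
          & exists (le : rel 'Z_n) (sigma : {additive 'Z_n -> 'Z_n}),
              [/\ is_kunz_poset (@phi R n @` F) le,
                  bijective sigma,
                  sigma 1 = (crd (pad z) n)%:~R
                & forall i j : 'Z_n,
                    semigroup_kunz_le S (sigma i) (sigma j) <-> le i j]]].
Proof.
split; [exact: phi_linear | exact: phi_bij |].
move=> F z S FO zF zS; have nz : n%:R != 0 :> R by rewrite pnatr_eq0; lia.
have FC : F `<=` @oversemigroup_cone' R n.
  by have [c [d [_ ->]]] := FO => v [].
have uU := corresponds_unit hn zS.
have [le_refl le_anti le_trans le0] := semigroup_kunz_le_order hn zS.
split; [exact: phi_face | |].
  (* The image of the integer point serves for every [h]: [n] times its coordinate is a nonzero
     Apery element. *)
  move=> h h0; exists (phi (map_mx intr z)).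
    by exists (map_mx intr z) => //; case: zF.
  rewrite crd_phi_intr ?ltn_Zp // mulf_eq0 invr_eq0 (negPf nz) orbF intr_eq0.
  exact: (apery_neq0 hn zS).
set u : 'Z_n := (crd (pad z) n)%:~R in uU le_refl le_anti le_trans le0 *.
(* The order is pulled back along [sigma], multiplication by [u], so only the Kunz condition takes
   work. *)
exists [rel i j | `[< semigroup_kunz_le S (u * i) (u * j) >]].
exists (u \*o idfun); split=> [|||i j] /=; last first.
- by split=> [/asboolP|/asboolP].
- by rewrite mulr1.
- by exists ( *%R u^-1) => i /=; rewrite ?mulKr ?mulVKr.
split=> // a b a0 b0 ab0.
(* The subadditivity defect at [(a, b)]: linear, and nonnegative on [F]. *)
pose l (w : 'rV[R]_n.-1) :=
  crd (phi w) a + crd (phi w) b - crd (phi w) (a + b)%R.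
have l_lin : scalar l.
  by move=> c v w; rewrite /l phi_linear !crd_linear; ring.
have l_ge0 w : F w -> 0 <= l w.
  by move=> /FC/(group_cone_phi w hn) Cw; rewrite subr_ge0; apply: Cw.
have lz : l (map_mx intr z) = 0 <-> semigroup_kunz_le S (u * a) (u * (a + b)).
  rewrite semigroup_kunz_leE // apery_diff // /l !crd_phi_intr ?ltn_Zp //.
  rewrite -mulrDl -mulrBl -rmorphD -rmorphB /=.
  split=> [/eqP|->]; last by rewrite subrr mul0r.
  by rewrite mulf_eq0 invr_eq0 (negPf nz) orbF intr_eq0 subr_eq0 => /eqP.
(* One direction evaluates at [z]; the other spreads the vanishing from [z] to all of [F]. *)
split=> [Fab|/asboolP/lz lz0 _ [w Fw <-]].
  apply/asboolP/lz/eqP; rewrite subr_eq0 Fab //.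
  by exists (map_mx intr z) => //; case: zF.
apply/eqP; rewrite -subr_eq0; apply/eqP.
exact: (scalar_ge0_relative_interior l_lin l_ge0 zF).
Qed.
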